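(* Let $n,k\in\mathbb{N}$ with $k\ge 2$, and let $f(z)=\sum_{s=0}^\infty \mathcal{P}(n,k,s)\,z^s$ be the generating function of the number $\mathcal{P}(n,k,s)$ of $n$-ary words of length $s$ that contain no streak of length $k$. Then, as formal power series in $z$, $$f(z)=\frac{1}{\displaystyle\sum_{r=0}^n \psi_{k,r}\binom{n}{r}z^r}.$$
   Context: $\mathbb{N}=\{1,2,3,\ldots\}$. An $n$-ary word of length $s$ is a tuple $(a_1,\ldots,a_s)$ with entries in $\{1,2,\ldots,n\}$ (there is exactly one word of length $0$). A streak of length $k$ in a word is a strictly increasing contiguous subword of length $k$, i.e. consecutive entries $a_i<a_{i+1}<\cdots<a_{i+k-1}$. For $k\ge2$ and $r\in\mathbb{Z}$, $\psi_{k,r}=1$ if $r\equiv 0 \pmod k$, $\psi_{k,r}=-1$ if $r\equiv 1\pmod k$, and $\psi_{k,r}=0$ otherwise. *)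

(* Defs.v *)
From HB Require Import structures.
From mathcomp Require Import all_boot all_order all_algebra.
From mathcomp Require Import boolp.

Set Implicit Arguments.
Unset Strict Implicit.
Unset Printing Implicit Defensive.

Import GRing.Theory.
Local Open Scope ring_scope.

(* Formal power series: [p i] is the coefficient of z^i.  The wrapping record
   keeps the Cauchy product apart from the pointwise product that
   MathComp-Analysis puts on function types. *)
Record fps (R : Type) := Fps { fps_coef :> nat -> R }.

Notation "{ 'fps' R }" := (fps R) (at level 0, format "{ 'fps'  R }").

Lemma fpsP (R : Type) (p q : {fps R}) : p =1 q <-> p = q.
Proof. by split=> [|-> //]; case: p q => [p] [q] /= /funext ->. Qed.

HB.instance Definition _ (R : Type) := gen_eqMixin {fps R}.
HB.instance Definition _ (R : Type) := gen_choiceMixin {fps R}.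

Section FpsZmodule.
Variable R : zmodType.
Implicit Types p q r : {fps R}.

Definition fps_zero : {fps R} := Fps (fun _ => 0).
Definition fps_opp p : {fps R} := Fps (fun i => - p i).
Definition fps_add p q : {fps R} := Fps (fun i => p i + q i).

Fact fps_addA : associative fps_add.
Proof. by move=> p q r; apply/fpsP => i; exact: addrA. Qed.

Fact fps_addC : commutative fps_add.
Proof. by move=> p q; apply/fpsP => i; exact: addrC. Qed.

Fact fps_add0 : left_id fps_zero fps_add.
Proof. by move=> p; apply/fpsP => i; exact: add0r. Qed.

Fact fps_addN : left_inverse fps_zero fps_opp fps_add.
Proof. by move=> p; apply/fpsP => i; exact: addNr. Qed.

HB.instance Definition _ :=
  GRing.isZmodule.Build {fps R} fps_addA fps_addC fps_add0 fps_addN.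

End FpsZmodule.

Section FpsComRing.
Variable R : comNzRingType.
Implicit Types p q r : {fps R}.

Definition fps_one : {fps R} := Fps (fun i => (i == 0%N)%:R).
Definition fps_mul p q : {fps R} :=
  Fps (fun i => \sum_(j < i.+1) p j * q (i - j)%N).

Let trunc n p : {poly R} := \poly_(i < n.+1) p i.

Let fps_mul_trunc n p q i : (i <= n)%N ->
  fps_mul p q i = (trunc n p * trunc n q)`_i.
Proof.
move=> le_in; rewrite coefM; apply: eq_bigr => j _; rewrite !coef_poly !ltnS.
by rewrite (leq_trans (leq_subr _ _) le_in) (leq_trans _ le_in) // -ltnS.
Qed.

Fact fps_mulC : commutative fps_mul.
Proof.
by move=> p q; apply/fpsP => i; rewrite !(fps_mul_trunc _ _ (leqnn i)) mulrC.
Qed.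

Fact fps_mulA : associative fps_mul.
Proof.
move=> p q r; apply/fpsP => i.
transitivity ((trunc i p * (trunc i q * trunc i r))`_i).
  rewrite coefM; apply: eq_bigr => j _; rewrite coef_poly ltn_ord.
  by rewrite (fps_mul_trunc _ _ (leq_subr j i)).
rewrite mulrA coefM; apply: eq_bigr => j _.
by rewrite coef_poly ltnS leq_subr (@fps_mul_trunc i) // -ltnS.
Qed.

Fact fps_mul1 : left_id fps_one fps_mul.
Proof.
move=> p; apply/fpsP => i /=; rewrite big_ord_recl /= mul1r subn0.
by rewrite big1 ?addr0 // => j _; rewrite mul0r.
Qed.

Fact fps_mulD : left_distributive fps_mul +%R.
Proof.
move=> p q r; apply/fpsP => i /=; rewrite -big_split /=.
by apply: eq_bigr => j _; rewrite mulrDl.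
Qed.

Fact fps_one_neq0 : fps_one != 0.
Proof.
apply/eqP => /fpsP /(_ 0%N) /= /eqP; apply/negP; exact: oner_neq0.
Qed.

HB.instance Definition _ :=
  GRing.Zmodule_isComNzRing.Build {fps R}
    fps_mulA fps_mulC fps_mul1 fps_mulD fps_one_neq0.

Definition fpsZ : {fps R} := Fps (fun i => (i == 1%N)%:R).

End FpsComRing.

Notation "''z'" := (fpsZ _) (at level 0) : ring_scope.

Section FpsUnitRing.
Variable R : comUnitRingType.
Implicit Types p q : {fps R}.

Definition fps_unit : {pred {fps R}} := [pred p : {fps R} | p 0%N \is a GRing.unit].

(* The first n coefficients b_0, ..., b_(n-1) of the inverse of p, obtained by
   solving p_0 b_m + \sum_(j < m) p_(m-j) b_j = [m = 0] for b_m. *)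
Fixpoint fps_inv_prefix p (n : nat) : seq R :=
  if n is m.+1 then
    let b := fps_inv_prefix p m in
    rcons b ((p 0%N)^-1 * ((m == 0%N)%:R - \sum_(j < m) p (m - j)%N * b`_j))
  else [::].

Definition fps_inv p : {fps R} :=
  if p \in fps_unit then Fps (fun i => (fps_inv_prefix p i.+1)`_i) else p.

Let size_fps_inv_prefix p n : size (fps_inv_prefix p n) = n.
Proof. by elim: n => //= n IHn; rewrite size_rcons IHn. Qed.

Let nth_fps_inv_prefix p n i : (i < n)%N ->
  (fps_inv_prefix p n)`_i = (fps_inv_prefix p i.+1)`_i.
Proof.
elim: n => // n IHn; rewrite ltnS leq_eqVlt => /predU1P[-> //|lt_in].
by rewrite [LHS]nth_rcons size_fps_inv_prefix lt_in IHn.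
Qed.

Fact fps_mulVx : {in fps_unit, left_inverse 1 fps_inv *%R}.
Proof.
move=> p Up; rewrite mulrC /fps_inv Up; apply/fpsP => i.
rewrite [LHS]big_ord_recl subn0 [X in p _ * X]nth_rcons size_fps_inv_prefix.
rewrite ltnn eqxx mulVKr //.
suff -> : \sum_(j < i) p (i - j)%N * (fps_inv_prefix p i)`_j =
          \sum_(j < i) p (lift ord0 j) * (fps_inv_prefix p (i - lift ord0 j).+1)`_(i - lift ord0 j).
  by rewrite subrK.
rewrite (reindex_inj rev_ord_inj) /=; apply: eq_bigr => j _.
rewrite nth_fps_inv_prefix; last by rewrite ltn_subrL (leq_ltn_trans _ (ltn_ord j)).
by rewrite subKn.
Qed.

Fact fps_unitPl p q : q * p = 1 -> fps_unit p.
Proof.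
move=> /fpsP /(_ 0%N); rewrite [LHS]big_ord1 /= mulrC => qp1.
by apply/unitrPr; exists (q 0%N).
Qed.

Fact fps_inv_out : {in [predC fps_unit], fps_inv =1 id}.
Proof. by move=> p; rewrite inE /fps_inv => /negPf ->. Qed.

HB.instance Definition _ :=
  GRing.ComNzRing_hasMulInverse.Build {fps R} fps_mulVx fps_unitPl fps_inv_out.

End FpsUnitRing.

(* Letters are 0, ..., n - 1 instead of 1, ..., n. *)
Definition strictly_increasing (n : nat) (u : seq 'I_n) : bool :=
  sorted (fun a b : 'I_n => (a < b)%N) u.

Definition has_streak (n k : nat) (w : seq 'I_n) : bool :=
  [exists u : k.-tuple 'I_n, strictly_increasing u && infix u w].

Definition num_streak_free (n k s : nat) : nat :=
  #|[set w : s.-tuple 'I_n | ~~ has_streak k w]|.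

Definition psi (k : nat) (r : int) : int :=
  if (r == 0 %[mod k])%Z then 1 else if (r == 1 %[mod k])%Z then -1 else 0.

Definition streak_free_gf (n k : nat) : {fps int} :=
  Fps (fun s => (num_streak_free n k s)%:Z).

Lemma streak_denominator_unit (n k : nat) :
  (\sum_(r < n.+1) (psi k r%:Z * 'C(n, r)%:Z)%:~R * 'z ^+ r : {fps int})
    \is a GRing.unit.
Proof.
pose c0 (p : {fps int}) := p 0%N.
have c0D : {morph c0 : p q / p + q} by [].
have c0M : {morph c0 : p q / p * q} by move=> p q; rewrite /c0 [LHS]big_ord1.
have c0X (p : {fps int}) : p 0%N \is a GRing.unit -> p \is a GRing.unit by [].
apply: c0X; rewrite -/(c0 _) big_ord_recl c0D (big_morph c0 c0D (erefl _)).
rewrite big1 => [|r _]; first by rewrite addr0 /psi eqxx mul1r bin0 mulr1 unitr1.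
by rewrite c0M exprS c0M (_ : c0 'z = 0) ?mul0r ?mulr0.
Qed.

(* Main.v *)
Require Import Defs.
From mathcomp Require Import all_boot all_order all_algebra.
From mathcomp Require Import zify.

(** Multiplying out, the theorem says that the convolution of
    psi k r * 'C(n, r) with the number of streak-free words is 1 in degree 0
    and 0 in every degree s > 0.  Since 'C(n, r) counts the strictly
    increasing words of length r, the product 'C(n, r) * num_streak_free n k
    (s - r) counts the words w of length s whose first r letters increase and
    whose remaining letters contain no streak ([card_increasing_then_free]).
    Exchanging the two sums, it suffices to show that for each nonempty word w
    the numbers psi k r, over all r that cut w in this way, add up to 0
    ([sum_psi_word]).

    Let m > 0 be the length of the longest increasing prefix of w.  The first r
    letters increase iff r <= m.  A streak in the rest cannot straddle position
    m, where w stops increasing, so it lies either in the m - r letters left of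
    the first run, which contain a streak iff m - r >= k, or beyond m.  Hence if w
    has a streak beyond m no r qualifies, and otherwise the admissible r are
    exactly those with m - k < r <= m.  This window either consists of k
    consecutive integers, and then contains one residue 0 and one residue 1
    modulo k, or is the interval from 0 to m with 1 <= m < k - 1; in both cases
    psi k sums to 1 - 1 = 0 over it ([sum_psi_window]). *)

Set Implicit Arguments.
Unset Strict Implicit.
Unset Printing Implicit Defensive.

Import GRing.Theory.
Local Open Scope ring_scope.

Lemma coef_fpsZn (R : comNzRingType) r i : ('z ^+ r : {fps R}) i = (i == r)%:R.
Proof.
elim: r i => [|r IHr] i; first by rewrite expr0.
rewrite exprS [LHS]/=; case: i => [|i]; first by rewrite big_ord1 mul0r.
rewrite big_ord_recl mul0r add0r big_ord_recl mul1r IHr subSS subn0 eqSS.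
by rewrite big1 ?addr0 // => j _; rewrite mul0r.
Qed.

Lemma coef_fps_sum (R : zmodType) (I : Type) (s : seq I) (P : pred I)
    (F : I -> {fps R}) i :
  (\sum_(j <- s | P j) F j : {fps R}) i = \sum_(j <- s | P j) F j i.
Proof. exact: (big_morph (fun p : {fps R} => p i)). Qed.

Lemma coef_fpsMz (R : zmodType) (p : {fps R}) (c : int) i :
  (p *~ c) i = p i *~ c.
Proof.
have coefMn m : (p *+ m) i = p i *+ m.
  by elim: m => [|m IHm]; rewrite ?mulr0n // !mulrS -IHm.
by case: c => m; [exact: coefMn | rewrite NegzE !mulrNz -!pmulrn /= coefMn].
Qed.

(** The formula holds beyond degree n as well, the binomial coefficient being
    zero there; so no case distinction on the degree is needed later. *)
Lemma coef_streak_denominator n k i :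
  (\sum_(r < n.+1) (psi k r%:Z * 'C(n, r)%:Z)%:~R * 'z ^+ r : {fps int}) i
  = psi k i%:Z * 'C(n, i)%:Z.
Proof.
rewrite coef_fps_sum.
under eq_bigr => r _ do rewrite mulrzl coef_fpsMz coef_fpsZn -mulrzl intz.
case: (ltnP i n.+1) => [lt_in | le_ni].
  rewrite (bigD1 (Ordinal lt_in)) //= eqxx mulr1 big1 ?addr0 // => r.
  by rewrite eq_sym -val_eqE /= => /negPf ->; rewrite mulr0.
rewrite bin_small // mulr0 big1 // => r _.
by rewrite gtn_eqF ?mulr0 // (leq_trans (ltn_ord r)).
Qed.

(** Streaks are handled through the positions of the ascents of a word: a factor
    is increasing iff all its positions but the last are ascents, which turns
    prefixes, suffixes and streaks into statements about intervals of nat.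
    The default value 0 is never reached, as ascents are only considered at
    positions j with j.+1 < size w. *)
Definition ascent n (w : seq 'I_n) j :=
  (nth 0 (map val w) j < nth 0 (map val w) j.+1)%N.

Lemma ascent_drop n (w : seq 'I_n) r j : ascent (drop r w) j = ascent w (r + j).
Proof. by rewrite /ascent map_drop !nth_drop addnS. Qed.

Lemma increasingP n (w : seq 'I_n) :
  reflect (forall j, j.+1 < size w -> ascent w j)%N (strictly_increasing w).
Proof.
have -> : strictly_increasing w = sorted ltn (map val w) by rewrite sorted_map.
by rewrite -(size_map val); exact: sortedP.
Qed.

Lemma increasing_takeP n (w : seq 'I_n) m : (m <= size w)%N ->
  reflect (forall j, j.+1 < m -> ascent w j)%N (strictly_increasing (take m w)).
Proof.
move=> le_mw; apply: (iffP (increasingP _)); rewrite size_takel // => asc j lt_jm.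
  by move: (asc j lt_jm); rewrite /ascent map_take !nth_take // ltnW.
by rewrite /ascent map_take !nth_take //; [exact: asc | exact: ltnW].
Qed.

(** Streaks of a suffix are located by their position in the whole word, so that
    the streaks of different suffixes of the same word can be compared. *)
Lemma streak_dropP n k (w : seq 'I_n) r : (r <= size w)%N ->
  reflect (exists i, [/\ r <= i, i + k <= size w &
             forall j, i <= j -> j.+1 < i + k -> ascent w j])%N
          (has_streak k (drop r w)).
Proof.
move=> le_rw; apply: (iffP existsP) => [[u /andP[u_inc /infixP[s1 [s2 eq_w]]]]|].
  have sz : (size (drop r w) = size s1 + (k + size s2))%N.
    by rewrite eq_w !size_cat size_tuple.
  rewrite size_drop in sz.
  exists (r + size s1)%N; split; try lia.
  move=> j le_ij lt_jk; have -> : (j = r + (size s1 + (j - r - size s1)))%N by lia.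
  rewrite -ascent_drop -ascent_drop eq_w drop_size_cat //.
  move/increasingP: u_inc => /(_ (j - r - size s1)%N); rewrite size_tuple => asc.
  have := asc ltac:(lia).
  by rewrite /ascent map_cat !nth_cat !size_map !size_tuple !ifT //; lia.
case=> i [le_ri le_ik asc].
have sz : size (take k (drop i w)) == k by rewrite size_takel // size_drop; lia.
exists (Tuple sz); apply/andP; split.
  apply/increasing_takeP; first by rewrite size_drop; lia.
  by move=> j lt_jk; rewrite ascent_drop asc //; lia.
apply/infixP; exists (take (i - r) (drop r w)), (drop k (drop i w)).
rewrite /= cat_take_drop.
by rewrite -{1}(cat_take_drop (i - r) (drop r w)) drop_drop subnK.
Qed.

(** The first maximal run of a nonempty word: its length m is positive because a
    single letter is increasing, and maximality makes m.-1 a non-ascent. *)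
Lemma initial_runP n (w : seq 'I_n) : (0 < size w)%N ->
  exists m, [/\ 0 < m <= size w, forall j, j.+1 < m -> ascent w j &
               m < size w -> ~~ ascent w m.-1]%N.
Proof.
move=> w_gt0.
pose P m := (0 < m <= size w)%N && strictly_increasing (take m w).
have exP : exists m, P m.
  exists 1%N; rewrite /P w_gt0 /=; apply/increasing_takeP => //.
have ubP m : P m -> (m <= size w)%N by case/andP=> /andP[].
case: (ex_maxnP exP ubP) => m /andP[m_bd inc] maxm.
have le_mw : (m <= size w)%N by case/andP: m_bd.
move/(increasing_takeP le_mw): inc => asc.
exists m; split=> // lt_mw; apply/negP => asc_m.
suff /maxm : P m.+1 by rewrite ltnn.
rewrite /P lt_mw; apply/increasing_takeP => // j.
rewrite ltnS leq_eqVlt => /predU1P[jm|]; last exact: asc.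
by rewrite -jm /= in asc_m.
Qed.

(** Since r.+1 = 1 and r = 0 are the same condition modulo k, psi is a discrete
    derivative, and its sums over intervals telescope. *)
Lemma psi_telescope k r : (1 < k)%N ->
  psi k r%:Z = (r.+1 == 1 %[mod k])%N%:Z - (r == 1 %[mod k])%N%:Z.
Proof.
move=> k_gt1; rewrite /psi !modz_nat !eqz_nat -[r.+1]addn1.
rewrite (_ : (r + 1 == 1 %[mod k]) = (r == 0 %[mod k]))%N; last first.
  by rewrite -{2}[1%N]add0n eqn_modDr.
rewrite [(0 %% k)%N]mod0n; case: eqP => [->|_].
  by rewrite (modn_small k_gt1).
by rewrite sub0r; case: eqP.
Qed.

(** The truncated lower bound covers both shapes of window: for k <= m.+1 the
    endpoints are congruent modulo k; otherwise the window starts at 0 and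
    neither 0 nor m.+1, which lies strictly between 1 and k, is 1 modulo k. *)
Lemma sum_psi_window k m : (1 < k)%N -> (0 < m)%N ->
  \sum_(m.+1 - k <= r < m.+1) psi k r%:Z = 0.
Proof.
move=> k_gt1 m_gt0; under eq_bigr => r _ do rewrite psi_telescope //.
rewrite telescope_sumr ?leq_subr //; case: (leqP k m.+1) => [le_km|lt_mk].
  by rewrite -{1}(subnK le_km) modnDr subrr.
rewrite (eqP (ltnW lt_mk)) mod0n !modn_small //.
by case: m m_gt0 lt_mk.
Qed.

Definition increasing_then_free n k (w : seq 'I_n) r :=
  strictly_increasing (take r w) && ~~ has_streak k (drop r w).

(** The cancellation behind the theorem, word by word: the admissible cut
    positions form a window that ends at the length m of the first run. *)
Lemma sum_psi_word n k (w : seq 'I_n) : (1 < k)%N ->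
  \sum_(r < (size w).+1) psi k r%:Z * (increasing_then_free k w r)%:Z
  = (size w == 0)%N%:Z.
Proof.
move=> k_gt1; case: (posnP (size w)) => [/size0nil -> | w_gt0].
  rewrite big_ord1 /psi /increasing_then_free /= eqxx mul1r.
  suff /negPf-> : ~~ has_streak k ([::] : seq 'I_n) by [].
  by apply/negP => /(@streak_dropP n k [::] 0 isT)[i [_ /= le_ik0 _]]; lia.
have [m [m_bd asc desc]] := initial_runP w_gt0.
have le_mw : (m <= size w)%N by case/andP: m_bd.
(* Only the lower bound of the window and the condition on drop m w come from
   the streaks; the upper bound r < m.+1 says that take r w is increasing. *)
have itfE r : (r <= size w)%N -> increasing_then_free k w r =
    (m.+1 - k <= r < m.+1)%N && ~~ has_streak k (drop m w).
  move=> le_rw; rewrite /increasing_then_free.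
  case: (increasing_takeP le_rw) => [inc_r|ninc]; last first.
    case: (ltnP r m.+1) => [lt_rm|]; last by rewrite andbF.
    by case: ninc => j lt_jr; apply: asc; lia.
  have le_rm : (r <= m)%N.
    rewrite leqNgt; apply/negP => lt_mr.
    by have /negP := desc (leq_trans lt_mr le_rw); apply; apply: inc_r; lia.
  rewrite ltnS le_rm andbT /= -[(_ <= r)%N]negbK -negb_or; congr (~~ _).
  apply/(streak_dropP k le_rw)/orP => [[i [le_ri le_ik asc_i]]|].
    case: (leqP m i) => [le_mi|lt_im].
      by right; apply/streak_dropP => //; exists i; split.
    (* A streak that begins before m and ends after it would make the
       non-ascent m.-1 an ascent. *)
    left; rewrite -ltnNge; case: (leqP (i + k) m) => [|lt_mik]; first by lia.
    by have /negP[] := desc ltac:(lia); apply: asc_i; lia.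
  case=> [lt_rk|/(streak_dropP k le_mw)[i [le_mi le_ik asc_i]]].
    by exists r; split=> [||j _ lt_j]; [..|apply: asc]; lia.
  by exists i; split=> //; lia.
under eq_bigr => r _ do rewrite (itfE _ (ltn_ord r)).
case: (has_streak k (drop m w)).
  by rewrite big1 // => r _; rewrite andbF mulr0.
have m_gt0 : (0 < m)%N by case/andP: m_bd.
apply: etrans (sum_psi_window k_gt1 m_gt0).
rewrite (big_nat_widenl _ 0) // (big_nat_widen _ _ (size w).+1) // big_mkord.
rewrite [RHS]big_mkcond; apply: eq_bigr => r _ /=.
by rewrite !andbT; case: ifP; rewrite ?mulr1 ?mulr0.
Qed.

Lemma card_increasing n r :
  #|[set u : r.-tuple 'I_n | strictly_increasing u]| = 'C(n, r).
Proof.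
rewrite -card_ltn_sorted_tuples; apply: eq_card => u.
by rewrite !inE sorted_map.
Qed.

(** Cutting at position r and concatenating are inverse bijections between
    these words and pairs of an increasing and a streak-free word. *)
Lemma card_increasing_then_free n k r t :
  #|[set w : (r + t).-tuple 'I_n | increasing_then_free k w r]|
  = ('C(n, r) * num_streak_free n k t)%N.
Proof.
rewrite -card_increasing -cardsX.
pose f (p : r.-tuple 'I_n * t.-tuple 'I_n) := [tuple of p.1 ++ p.2].
have f_inj : injective f.
  move=> [u v] [u' v'] /(congr1 val) /= /eqP.
  rewrite eqseq_cat ?size_tuple // => /andP[/eqP/val_inj-> /eqP/val_inj->] //.
rewrite -(card_imset _ f_inj); apply: eq_card => w; rewrite inE.
have size_take_w : size (take r w) == r by rewrite size_takel ?size_tuple ?leq_addr.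
have size_drop_w : size (drop r w) == t by rewrite size_drop size_tuple addKn.
apply/idP/imsetP => [/andP[inc free]|[[u v]]].
  exists (Tuple size_take_w, Tuple size_drop_w); first by rewrite !inE; apply/andP.
  by apply: val_inj; rewrite /= cat_take_drop.
rewrite !inE => /andP[/= inc free] ->.
by rewrite /increasing_then_free /= take_size_cat ?drop_size_cat ?size_tuple ?inc.
Qed.

(** Double counting: the left-hand side sums psi k r over all pairs of a word of
    length s and an admissible cut r of it; summing over the cuts first leaves
    only the empty word. *)
Lemma streak_free_recurrence n k s : (1 < k)%N ->
  \sum_(r < s.+1) psi k r%:Z * 'C(n, r)%:Z * (num_streak_free n k (s - r))%:Z
  = (s == 0)%N%:Z.
Proof.
move=> k_gt1.
transitivity (\sum_(w : s.-tuple 'I_n) \sum_(r < (size w).+1)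
                psi k r%:Z * (increasing_then_free k w r)%:Z); last first.
  under eq_bigr => w _ do rewrite sum_psi_word // size_tuple.
  case: s => [|s]; last by rewrite big1.
  by rewrite sumr_const card_tuple.
under [RHS]eq_bigr => w _ do rewrite size_tuple.
rewrite exchange_big; apply: eq_bigr => r _; rewrite -mulr_sumr -mulrA; congr (_ * _).
rewrite -PoszM -card_increasing_then_free subnKC -1?ltnS //.
rewrite -sum1_card (big_morph Posz PoszD (erefl _)) big_mkcond.
by apply: eq_bigr => w _; rewrite inE; case: ifP.
Qed.

Theorem theorem3p6 (n k : nat) (hn : (1 <= n)%N) (hk : (2 <= k)%N) :
  streak_free_gf n k =
    1 / (\sum_(r < n.+1) (psi k r%:Z * 'C(n, r)%:Z)%:~R * 'z ^+ r).
Proof.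
apply: (canRL (mulrK (streak_denominator_unit n k))); rewrite mulrC.
apply/fpsP => s; rewrite [LHS]/=.
under eq_bigr => r _ do rewrite coef_streak_denominator.
by rewrite streak_free_recurrence //; case: s.
Qed.
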